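(* Let $\delta>0$. For every function $f:(-2\delta,-\delta]\to\mathbb{R}$ there is a unique function $y:(-\infty,0)\to\mathbb{R}$ such that $y(x)=y(2x)$ for all $x\in(-\infty,0)$ and $y(x)=f(x)$ for all $x\in(-2\delta,-\delta]$.
   Context: No continuity is assumed. *)

(* Defs.v *)
From mathcomp Require Import all_boot all_order all_algebra.
From mathcomp Require Import reals.

Set Implicit Arguments.
Unset Strict Implicit.
Unset Printing Implicit Defensive.

Import Order.TTheory GRing.Theory Num.Theory.
Local Open Scope ring_scope.

(* Functions on an interval are functions on the corresponding subtype; since
   interval membership is boolean, elements are equal iff their values are. *)
Definition neg_reals (R : realType) : Type := {x : R | x \in `]-oo, 0[}.

Definition base_interval (R : realType) (delta : R) : Type :=
  {x : R | x \in `]- (2 * delta), - delta]}.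

Lemma double_neg_subproof (R : realType) (x : neg_reals R) :
  2 * sval x \in `]-oo, 0[.
Proof.
by case: x => x /=; rewrite !in_itv /= => x_lt0; rewrite pmulr_rlt0 // ltr0n.
Qed.

Definition double_neg (R : realType) (x : neg_reals R) : neg_reals R :=
  exist _ (2 * sval x) (double_neg_subproof x).

Lemma base_to_neg_subproof (R : realType) (delta : R) (delta_gt0 : 0 < delta)
  (x : base_interval delta) : sval x \in `]-oo, 0[.
Proof.
case: x => x /=; rewrite !in_itv /= => /andP[_ x_le].
by apply: le_lt_trans x_le _; rewrite oppr_lt0.
Qed.

Definition base_to_neg (R : realType) (delta : R) (delta_gt0 : 0 < delta)
  (x : base_interval delta) : neg_reals R :=
  exist _ (sval x) (base_to_neg_subproof delta_gt0 x).

(* Main.v *)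
(** Every orbit of the doubling map on the negative reals meets the half-open
    interval ]-2d, -d] in exactly one point, since consecutive dyadic scales of
    that interval tile ]-oo, 0[.  A solution is constant on orbits, so it sends
    [x] to the value of [f] at the representative of the orbit of [x]. *)
Require Import Defs.
From mathcomp Require Import all_boot all_order all_algebra.
From mathcomp Require Import boolp reals.

Import Order.TTheory GRing.Theory Num.Theory.
Local Open Scope ring_scope.

(** The least exponent is sought in [nat], although [k] may be negative: [delta] is first scaled by
    [2 ^+ m] beyond [- x], so the least [n] with [- x * 2 ^+ n] reaching that threshold is
    positive. *)
Lemma dyadic_exponent_exists {R : archiRealFieldType} {delta x : R} :
  0 < delta -> x < 0 ->
  exists k : int, x * 2 ^ k \in `]- (2 * delta), - delta].
Proof.
move=> delta_gt0 x_lt0.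
pose m := Num.bound (- x / delta).
have small_m : - x < delta * 2 ^+ m.
  by rewrite mulrC -ltr_pdivrMr //; apply: upper_nthrootP.
have ex_n : exists n, delta * 2 ^+ m <= - x * 2 ^+ n.
  exists (Num.bound (delta * 2 ^+ m / - x)).
  rewrite [leRHS]mulrC -ler_pdivrMr ?oppr_gt0 //; apply: ltW.
  exact: upper_nthrootP.
case: (ex_minnP ex_n) => [[|n]].
  by rewrite expr0 mulr1 leNgt small_m.
move=> ge_n min_n.
have lt_n : - x * 2 ^+ n < delta * 2 ^+ m.
  by rewrite ltNge; apply/negP => /min_n; rewrite ltnn.
have p_gt0 : 0 < 2 ^+ m :> R by rewrite exprn_gt0.
(* Failure of the threshold at [n] gives, after doubling, the strict bound by [2 * delta];
   subtracting [m] undoes the scaling. *)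
exists (n.+1%:Z - m%:Z).
rewrite expfzDr ?pnatr_eq0 // -invr_expz -!exprnP mulrA in_itv /=.
rewrite ltr_pdivlMr // ler_pdivrMr // !mulNr ltrNl lerNr -!mulNr ge_n andbT.
by rewrite exprS mulrCA -mulrA ltr_pM2l.
Qed.

(** Raising the exponent at least doubles a value that is already at most [- delta], pushing it to
    [- (2 * delta)] or below, outside the half-open interval. *)
Lemma dyadic_exponent_unique {R : realFieldType} {delta x : R} {k l : int} :
  0 < delta ->
  x * 2 ^ k \in `]- (2 * delta), - delta] ->
  x * 2 ^ l \in `]- (2 * delta), - delta] -> k = l.
Proof.
move=> delta_gt0; wlog lt_kl : k l / k < l => [wlt xk xl|].
  case: (ltgtP k l) => // [lt_kl | lt_lk]; first exact: wlt.
  by apply/esym/wlt.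
rewrite !in_itv /= => /andP[_ xk] /andP[xl _].
have x_le0 : x <= 0.
  rewrite -(pmulr_lle0 x (exprz_gt0 k (ltr0Sn R 1))).
  by apply: le_trans xk _; rewrite oppr_le0 ltW.
have le_2l : 2 * 2 ^ k <= 2 ^ l :> R.
  by rewrite -{1}[2]expr1z -expfzDr ?pnatr_eq0 // ler_eXz2l ?ltr1n // lez1D.
have := lt_le_trans xl (ler_wnM2l x_le0 le_2l).
by rewrite mulrCA -mulrN ltr_pM2l // ltNge xk.
Qed.

Lemma double_invariant_dyadic {R : realType} {T : Type} {y : neg_reals R -> T} :
  (forall x, y x = y (double_neg x)) ->
  forall (k : int) (a b : neg_reals R), sval b = sval a * 2 ^ k -> y a = y b.
Proof.
move=> y2.
have y2n n (a b : neg_reals R) : sval b = sval a * 2 ^+ n -> y a = y b.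
  elim: n a => [|n IHn] a ab.
    by congr y; apply: val_inj; rewrite /= ab mulr1.
  by rewrite y2; apply: IHn; rewrite /= ab exprS mulrCA mulrA.
case=> n a b ab; first exact: y2n ab.
(* For the negative exponent [- n.+1], exchange [a] and [b]. *)
apply/esym/(y2n n.+1); rewrite ab NegzE -invr_expz -exprnP divfK //.
by rewrite expf_neq0 ?pnatr_eq0.
Qed.

Section Extension.
Context {R : realType} {delta : R} (delta_gt0 : 0 < delta).

Definition orbit_exponent (x : neg_reals R) : int :=
  xchoose (dyadic_exponent_exists delta_gt0 (svalP x)).

Lemma orbit_exponentP (x : neg_reals R) :
  sval x * 2 ^ orbit_exponent x \in `]- (2 * delta), - delta].
Proof. exact: (xchooseP (dyadic_exponent_exists delta_gt0 (svalP x))). Qed.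

Definition orbit_repr (x : neg_reals R) : base_interval delta :=
  exist _ (sval x * 2 ^ orbit_exponent x) (orbit_exponentP x).

(** Uniqueness of the exponent makes the outcome of [xchoose] irrelevant: any exponent that lands in
    the interval identifies the representative. *)
Lemma orbit_repr_eq (x : neg_reals R) (z : base_interval delta) (k : int) :
  sval z = sval x * 2 ^ k -> orbit_repr x = z.
Proof.
move=> zE; apply: val_inj; rewrite /= zE.
congr (_ * 2 ^ _); apply: (dyadic_exponent_unique delta_gt0 (orbit_exponentP x)).
by rewrite -zE; apply: svalP z.
Qed.

Lemma orbit_repr_double (x : neg_reals R) :
  orbit_repr x = orbit_repr (double_neg x).
Proof.
apply: (@orbit_repr_eq _ _ (1 + orbit_exponent (double_neg x))).
by rewrite /= expfzDr ?pnatr_eq0 // expr1z mulrCA mulrA.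
Qed.

Lemma orbit_repr_base (z : base_interval delta) :
  orbit_repr (base_to_neg delta_gt0 z) = z.
Proof. by apply: (@orbit_repr_eq _ _ 0); rewrite /= expr0z mulr1. Qed.

End Extension.

Theorem theorem3p6 (R : realType) (delta : R) (delta_gt0 : 0 < delta)
    (f : base_interval delta -> R) :
  exists! y : neg_reals R -> R,
    (forall x : neg_reals R, y x = y (double_neg x)) /\
    (forall x : base_interval delta, y (base_to_neg delta_gt0 x) = f x).
Proof.
exists (fun x => f (orbit_repr delta_gt0 x)); split.
  by split=> x; rewrite ?orbit_repr_base // orbit_repr_double.
(* Reading [yf] backwards turns [f] at the representative into [y] at a point of the orbit of
   [x]. *)
move=> y [y2 yf]; apply: funext => x; rewrite -yf.
exact/esym/(double_invariant_dyadic y2 (orbit_exponent delta_gt0 x)).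
Qed.
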